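(* For every set of formulas $\Gamma$ and every formula $\varphi$, $\Gamma\vdash_{\mathbf{K}}\varphi \iff \Gamma\vDash_{\mathbf{K}}\varphi$.
   Context: Formulas are built from a countable set $PL$ of propositional letters and the constant $\bot$ using $\land,\lor,\to$; $\neg\alpha:=\alpha\to\bot$, $\top:=\bot\to\bot$. For a Kripke frame $\mathfrak F=\langle W,R\rangle$ and $X\subseteq W$ let $\Box_{\mathfrak F}X=\{w\mid \forall v\,(wRv\Rightarrow v\in X)\}$ and $\Diamond^{-1}_{\mathfrak F}X=\{w\in W\mid \exists x\in X,\ xRw\}$ (the converse/''past'' diamond). $FP_{\mathfrak F}=\{\Box_{\mathfrak F}X\mid X\subseteq W\}$, the set of fixpoints of the closure operator $\Box_{\mathfrak F}\Diamond^{-1}_{\mathfrak F}$. A $\Box\Diamond^{-1}$-model is a Kripke model $\langle\mathfrak F,V\rangle$ with $V(p)\in FP_{\mathfrak F}$ for all $p\in PL$. Truth sets: $\|p\|=V(p)$, $\|\bot\|=\Box_{\mathfrak F}\emptyset$, $\|\alpha\land\beta\|=\|\alpha\|\cap\|\beta\|$, $\|\alpha\to\beta\|=\Box_{\mathfrak F}((W\setminus\|\alpha\|)\cup\|\beta\|)$, $\|\alpha\lor\beta\|=\Box_{\mathfrak F}\Diamond^{-1}_{\mathfrak F}(\|\alpha\|\cup\|\beta\|)$; $\mathfrak M,w\vDash\varphi$ iff $w\in\|\varphi\|$. $\vDash_{\mathbf K}$ is the local consequence relation over the class of all $\Box\Diamond^{-1}$-models ($\Gamma\vDash_{\mathbf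 K}\varphi$ iff at every point of every such model where all of $\Gamma$ holds, $\varphi$ holds). $\vdash_{\mathbf K}$ is the smallest relation $\vdash\subseteq Form\times Form$ satisfying the following basic rules (where ''$\vdash\alpha$'' means $\chi\vdash\alpha$ for every $\chi$): (A) $\alpha\vdash\alpha$; (Cut) $\alpha\vdash\beta$ and $\beta\vdash\gamma$ imply $\alpha\vdash\gamma$; ($\bot$) $\bot\vdash\alpha$; ($\land$R) $\chi\vdash\alpha$ and $\chi\vdash\beta$ imply $\chi\vdash\alpha\land\beta$; ($\land$L) $\alpha\land\beta\vdash\alpha$, $\alpha\land\beta\vdash\beta$; ($\lor$R) $\alpha\vdash\alpha\lor\beta$, $\beta\vdash\alpha\lor\beta$; ($\lor$L) $\alpha\vdash\chi$ and $\beta\vdash\chi$ imply $\alpha\lor\beta\vdash\chi$; (DT$_0$) $\alpha\vdash\beta$ implies $\vdash\alpha\to\beta$; ($\to\land$) $(\alpha\to\beta)\land(\alpha\to\gamma)\vdash\alpha\to\beta\land\gamma$; ($\to$tr) $(\alpha\to\beta)\land(\beta\to\gamma)\vdash\alpha\to\gamma$; ($\to$-$\lor$.s) for each $n\ge1$, $\bigvee_{j}(\alpha_j\to\beta_j)\land\bigwedge_j(\psi_j\land\beta_j\to\chi)\vdash\bigwedge_j(\psi_j\land\alpha_j)\to\chi$. It is extended to sets: $\Gamma\vdash\alpha$ iff $\bigwedge\Gamma_0\vdash\alpha$ for some finite $\Gamma_0\subseteq\Gamma$ (with $\bigwedge\emptyset=\top$). *)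

(* Defs.v *)
From Stdlib Require List.
From mathcomp Require Import all_boot.
From mathcomp Require Import boolp classical_sets.

Set Implicit Arguments.
Unset Strict Implicit.
Unset Printing Implicit Defensive.

Local Open Scope classical_set_scope.

Inductive form (PL : Type) : Type :=
| Var of PL
| Bot
| And of form PL & form PL
| Or of form PL & form PL
| Imp of form PL & form PL.

Arguments Bot {PL}.

Definition Top {PL : Type} : form PL := Imp Bot Bot.

(* The empty conjunction is Top, but no spurious Top is added to nonempty
   ones: bigAnd [:: a1; a2; a3] is And a1 (And a2 a3). *)
Fixpoint bigAnd {PL : Type} (s : seq (form PL)) : form PL :=
  match s with
  | [::] => Top
  | [:: a] => a
  | a :: s' => And a (bigAnd s')
  end.

Fixpoint bigOr {PL : Type} (s : seq (form PL)) : form PL :=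
  match s with
  | [::] => Bot
  | [:: a] => a
  | a :: s' => Or a (bigOr s')
  end.

Record frame : Type := Frame {
  world : Type;
  acc : world -> world -> Prop
}.

Definition box (F : frame) (X : set (world F)) : set (world F) :=
  [set w | forall v, acc w v -> X v].

Definition pdia (F : frame) (X : set (world F)) : set (world F) :=
  [set w | exists2 x, X x & acc x w].

Definition FP (F : frame) : set (set (world F)) := range (@box F).

Record bd_model (PL : Type) : Type := BdModel {
  mframe : frame;
  valuation : PL -> set (world mframe);
  valuation_FP : forall p, FP (valuation p)
}.

Arguments valuation {PL} M p : rename.

Fixpoint truth (PL : Type) (M : bd_model PL) (a : form PL) :
    set (world (mframe M)) :=
  match a with
  | Var p => valuation M p
  | Bot => box set0
  | And a b => @truth PL M a `&` @truth PL M b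
  | Or a b => box (pdia (@truth PL M a `|` @truth PL M b))
  | Imp a b => box (~` @truth PL M a `|` @truth PL M b)
  end.

Arguments truth {PL} M a.

Definition entails_K (PL : Type) (G : set (form PL)) (a : form PL) : Prop :=
  forall (M : bd_model PL) (w : world (mframe M)),
    (forall g, G g -> truth M g w) -> truth M a w.

Inductive derives_K (PL : Type) : form PL -> form PL -> Prop :=
| K_A a : derives_K a a
| K_Cut a b c : derives_K a b -> derives_K b c -> derives_K a c
| K_Bot a : derives_K Bot a
| K_AndR x a b : derives_K x a -> derives_K x b -> derives_K x (And a b)
| K_AndL1 a b : derives_K (And a b) a
| K_AndL2 a b : derives_K (And a b) b
| K_OrR1 a b : derives_K a (Or a b)
| K_OrR2 a b : derives_K b (Or a b)
| K_OrL a b x : derives_K a x -> derives_K b x -> derives_K (Or a b) x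
| K_DT0 a b x : derives_K a b -> derives_K x (Imp a b)
| K_ImpAnd a b c :
    derives_K (And (Imp a b) (Imp a c)) (Imp a (And b c))
| K_ImpTr a b c :
    derives_K (And (Imp a b) (Imp b c)) (Imp a c)
| K_ImpOrS (n : nat) (a b p : 'I_n.+1 -> form PL) (x : form PL) :
    derives_K
      (And (bigOr [seq Imp (a j) (b j) | j <- enum 'I_n.+1])
           (bigAnd [seq Imp (And (p j) (b j)) x | j <- enum 'I_n.+1]))
      (Imp (bigAnd [seq And (p j) (a j) | j <- enum 'I_n.+1]) x).

(* A finite subset of G is given by a list enumerating it. *)
Definition derivable_K (PL : Type) (G : set (form PL)) (a : form PL) : Prop :=
  exists2 s : seq (form PL), List.Forall G s & derives_K (bigAnd s) a.

(* Main.v *)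
Require Import Defs.
From Stdlib Require List.
From mathcomp Require Import all_boot.
From mathcomp Require Import boolp classical_sets.

(** Completeness uses a canonical model whose worlds are pairs [(T, phi)] of a
    theory and a formula that no predecessor of the world may contain.  Since
    the logic is not distributive, theories are not prime; instead,
    [(w, _)] sees [(v, phi)] when [w] contains no disjunction of [phi] with
    implications [a_j -> b_j] such that [v] contains [a_j] but not [b_j].
    The second components make every set of worlds [{w | a in w}] a fixpoint;
    the disjunctive form of the relation provides, for [a \/ b] in [w], a
    predecessor of [(v, phi)] generated by [a] or by [b]; and the rule
    [K_ImpOrS] is what turns a maximal theory avoiding all [c] with [c -> b]
    in [w] into a successor of [w] refuting [b]. *)

Set Implicit Arguments.
Unset Strict Implicit.
Unset Printing Implicit Defensive.

Local Open Scope classical_set_scope.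

(** * Soundness *)

Lemma pdia_box (F : frame) (X : set (world F)) : pdia (box X) `<=` X.
Proof. by move=> w [u uX /uX]. Qed.

Lemma FP_box_pdia (F : frame) (X : set (world F)) :
  FP X -> box (pdia X) `<=` X.
Proof. by case=> Y _ <- w wX v /wX/pdia_box. Qed.

Lemma FP_truth (PL : Type) (M : bd_model PL) (a : form PL) : FP (truth M a).
Proof.
elim: a => [p||a [X _ aX] b [Y _ bY]|a _ b _|a _ b _] /=; last 2 first.
- by eexists.
- by eexists.
- exact: valuation_FP.
- by exists set0.
exists (X `&` Y) => //; rewrite -aX -bY; apply/seteqP; split=> w.
  by move=> H; split=> v /H [].
by move=> [wX wY] v wv; split; [apply: wX|apply: wY].
Qed.

Lemma truth_bigAnd (PL : Type) (M : bd_model PL) (s : seq (form PL)) w :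
  truth M (bigAnd s) w -> List.Forall (fun a => truth M a w) s.
Proof.
elim: s => [|a [|b s] IH]; first by constructor.
  by move=> aw; do 2?constructor.
by case=> aw /IH; constructor.
Qed.

(** A disjunction true at [w] need not have a true disjunct there; it only gives each successor [v]
    of [w] some predecessor with one. The induction moves from [w] to that predecessor and keeps
    [v]. *)
Lemma truth_bigOr (PL : Type) (M : bd_model PL) (s : seq (form PL)) w v :
  truth M (bigOr s) w -> acc w v ->
  exists2 u, List.Exists (fun a => truth M a u) s & acc u v.
Proof.
elim: s w => [|a [|b s] IH] w; first by move=> H /H.
  by move=> aw wv; exists w => //; constructor.
move=> H /H [u [au|su] uv]; first by exists u => //; constructor.
by have [u' su' u'v] := IH _ su uv; exists u' => //; constructor 2.
Qed.

Lemma derives_K_sound (PL : Type) (M : bd_model PL) (a b : form PL) :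
  derives_K a b -> truth M a `<=` truth M b.
Proof.
elim=> {a b} /=.
- by move=> a w.
- by move=> a b c _ ab _ bc w /ab/bc.
- by move=> a w w0; have [X _ <-] := FP_truth M a; move=> v /w0.
- by move=> x a b _ xa _ xb w xw; split; [apply: xa|apply: xb].
- by move=> a b w [].
- by move=> a b w [].
- by move=> a b w aw v wv; exists w => //; left.
- by move=> a b w bw v wv; exists w => //; right.
- move=> a b x _ ax _ bx w abw; apply: FP_box_pdia; first exact: FP_truth.
  by move=> v /abw [u [/ax|/bx] xu uv]; exists u.
- move=> a b x _ ab w _ v _.
  by have [av|nav] := pselect (truth M a v); [right; apply: ab|left].
- move=> a b c w [ab ac] v wv.
  by case: (ab v wv) => [|bv]; [left|case: (ac v wv); [left|right]].
- move=> a b c w [ab bc] v wv.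
  by case: (ab v wv) => [|bv]; [left|case: (bc v wv) => // cv; right].
move=> n a b p x w [/truth_bigOr ab /truth_bigAnd px] v wv.
case: (pselect (truth M (bigAnd [seq And (p j) (a j) | j <- enum 'I_n.+1]) v));
  last by left.
move=> /truth_bigAnd pa; right.
(* The implication holds at [u] rather than at [w], which suffices because [u] also sees [v]. *)
have [u /List.Exists_map/List.Exists_exists [j [jI abj]] uv] := ab _ wv.
move/List.Forall_map/List.Forall_forall/(_ j jI): pa => /= [pj aj].
move/List.Forall_map/List.Forall_forall/(_ j jI)/(_ v wv): px => /=.
by case: (abj v uv) => // bj; case=> // -[].
Qed.

(** * Derivability and theories *)

(** Finitary character, for use with Zorn's lemma. The first alternative covers the empty chain,
    which has no member to choose. *)
Lemma Forall_chain_union (T : Type) (F : set (set T)) (A : set T) (s : seq T) :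
  total_on F subset -> List.Forall (A `|` \bigcup_(X in F) X) s ->
  List.Forall A s \/ exists2 X, F X & List.Forall (A `|` X) s.
Proof.
move=> Ftot; elim=> [|a t aF _ IH]; first by left.
have mono X Y : X `<=` Y -> List.Forall (A `|` X) t -> List.Forall (A `|` Y) t.
  by move=> XY; apply: List.Forall_impl => x [|/XY]; [left|right].
case: IH aF => [tA|[X FX tX]] [aA|[Y FY aY]].
- by left; constructor.
- right; exists Y => //; constructor; first by right.
  by apply: List.Forall_impl tA => x; left.
- by right; exists X => //; constructor => //; left.
right; have [XY|YX] := Ftot _ _ FX FY.
  by exists Y => //; constructor; [right|apply: mono tX].
by exists X => //; constructor => //; right; apply: YX.
Qed.

Section Theories.
Variable PL : Type.
Implicit Types (a b c x phi : form PL) (s : seq (form PL)) (G X : set (form PL)).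

Lemma derives_K_Top a : derives_K a Top.
Proof. exact/K_DT0/K_A. Qed.

Lemma derives_K_And a a' b b' :
  derives_K a a' -> derives_K b b' -> derives_K (And a b) (And a' b').
Proof.
by move=> aa bb; apply: K_AndR; [apply: K_Cut aa; apply: K_AndL1|
  apply: K_Cut bb; apply: K_AndL2].
Qed.

Lemma derives_K_bigAndR x s :
  List.Forall (derives_K x) s -> derives_K x (bigAnd s).
Proof.
elim=> [|a [|b t] xa _ IH] //; first exact: derives_K_Top.
exact: K_AndR xa IH.
Qed.

Lemma derives_K_bigAndL s : List.Forall (derives_K (bigAnd s)) s.
Proof.
elim: s => [|a [|b s] IH]; first by constructor.
  by do 2?constructor.
constructor; first exact: K_AndL1.
by apply: List.Forall_impl IH => c; apply: K_Cut; apply: K_AndL2.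
Qed.

Lemma derives_K_bigAnd_incl s t :
  List.incl t s -> derives_K (bigAnd s) (bigAnd t).
Proof.
move=> ts; apply/derives_K_bigAndR/List.Forall_forall => a /ts.
by move: a; apply/List.Forall_forall/derives_K_bigAndL.
Qed.

Record theory := Theory {
  thy :> form PL -> Prop;
  thy_Top : thy Top;
  thy_And a b : thy a -> thy b -> thy (And a b);
  thy_mono a b : derives_K a b -> thy a -> thy b
}.

Lemma thy_bigAnd (T : theory) s : List.Forall T s -> T (bigAnd s).
Proof.
elim=> [|a [|b t] Ta _ IH] //; first exact: thy_Top.
exact: thy_And Ta IH.
Qed.

Lemma thy_DT0 (T : theory) a b : derives_K a b -> T (Imp a b).
Proof. by move=> ab; apply: thy_mono (thy_Top T); apply: K_DT0. Qed.

Lemma thy_ImpTr (T : theory) a b c : T (Imp a b) -> T (Imp b c) -> T (Imp a c).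
Proof. by move=> Tab /(thy_And Tab); apply/thy_mono/K_ImpTr. Qed.

Definition derivable_theory G : theory.
Proof.
exists (derivable_K G).
- by exists [::] => //; apply: K_A.
- move=> a b [s Gs sa] [t Gt tb]; exists (s ++ t); first exact/List.Forall_app.
  apply: K_AndR; [apply: K_Cut sa|apply: K_Cut tb];
    apply: derives_K_bigAnd_incl => x xs; apply/List.in_or_app; by [left|right].
- by move=> a b ab [s Gs sa]; exists s => //; apply: K_Cut ab.
Defined.

Definition principal_theory a : theory.
Proof.
exists (derives_K a).
- exact: derives_K_Top.
- exact: K_AndR.
- by move=> b c bc ab; apply: K_Cut bc.
Defined.

Definition full_theory : theory.
Proof. by exists setT. Defined.

Lemma sub_derivable_K G a : G a -> derivable_K G a.
Proof. by move=> Ga; exists [:: a]; [do 2?constructor|apply: K_A]. Qed.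

(** Stands in for a deduction theorem: [K_DT0] discharges only a sole premise, so the contribution
    [c] of [G] stays conjoined with [a]. *)
Lemma derivable_K_setU1 G a b : derivable_K (a |` G) b ->
  exists2 c, derivable_K G c & derives_K (And c a) b.
Proof.
case=> s Gs sb.
suff [c Gc cs] : exists2 c, derivable_K G c & derives_K (And c a) (bigAnd s).
  by exists c => //; apply: K_Cut sb.
suff [c Gc cs] : exists2 c, derivable_K G c
    & List.Forall (derives_K (And c a)) s.
  by exists c => //; apply: derives_K_bigAndR.
elim: Gs => [|d t Gd _ [c Gc ct]].
  by exists Top; [apply: (thy_Top (derivable_theory G))|].
case: Gd => [->|Gd].
  by exists c => //; constructor => //; apply: K_AndL2.
exists (And d c).
  exact: (thy_And (t := derivable_theory G)) (sub_derivable_K Gd) Gc.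
constructor; first by apply: K_Cut (K_AndL1 _ _); apply: K_AndL1.
apply: List.Forall_impl ct => e; apply: K_Cut.
by apply: derives_K_And; [apply: K_AndL2|apply: K_A].
Qed.

(** * The canonical model *)

Definition disj_Imp phi (l : seq (form PL * form PL)) : form PL :=
  foldr (fun ab d => Or (Imp ab.1 ab.2) d) phi l.

Lemma disj_Imp_catl phi l1 l2 :
  derives_K (disj_Imp phi l1) (disj_Imp phi (l1 ++ l2)).
Proof.
elim: l1 => [|ab l1 IH] /=.
  by elim: l2 => [|ab l2 IH] /=; [apply: K_A|apply: K_Cut IH _; apply: K_OrR2].
by apply: K_OrL; [apply: K_OrR1|apply: K_Cut IH _; apply: K_OrR2].
Qed.

Lemma disj_Imp_catr phi l1 l2 :
  derives_K (disj_Imp phi l2) (disj_Imp phi (l1 ++ l2)).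
Proof.
by elim: l1 => [|ab l1 IH] /=; [apply: K_A|apply: K_Cut IH _; apply: K_OrR2].
Qed.

Lemma disj_Imp_Bot l :
  derives_K (disj_Imp Bot l) (bigOr [seq Imp ab.1 ab.2 | ab <- l]).
Proof.
elim: l => [|ab [|cd l] IH]; first exact: K_A.
  by apply: K_OrL; [apply: K_A|apply: K_Bot].
by apply: K_OrL; [apply: K_OrR1|apply: K_Cut IH _; apply: K_OrR2].
Qed.

Lemma derives_K_ImpOrS_seq (l : seq (form PL * form PL))
    (p : form PL * form PL -> form PL) x : l <> [::] ->
  derives_K
    (And (bigOr [seq Imp ab.1 ab.2 | ab <- l])
         (bigAnd [seq Imp (And (p ab) ab.2) x | ab <- l]))
    (Imp (bigAnd [seq And (p ab) ab.1 | ab <- l]) x).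
Proof.
case: l => // ab0 l _; set l' := ab0 :: l.
(* Here [l] is the tail, so [(size l).+1] is the length of [l'], as the indexing of [K_ImpOrS]
   requires. *)
have nthE (f : form PL * form PL -> form PL) :
    [seq f ab | ab <- l'] =
    [seq f (nth ab0 l' (val j)) | j <- enum 'I_(size l).+1].
  by rewrite (map_comp (fun i => f (nth ab0 l' i)) val) val_enum_ord
    -[RHS]/(map (f \o nth ab0 l') (iota 0 (size l'))) map_comp map_nth_iota0 // take_size.
rewrite !nthE; exact: (K_ImpOrS (fun j => (nth ab0 l' (val j)).1)
  (fun j => (nth ab0 l' (val j)).2) (fun j => p (nth ab0 l' (val j)))).
Qed.

Definition separated (v : form PL -> Prop) phi (w : form PL -> Prop) : Prop :=
  forall l, List.Forall (fun ab => v ab.1 /\ ~ v ab.2) l -> ~ w (disj_Imp phi l).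

Definition can_frame : frame :=
  @Frame (theory * form PL)%type (fun w v => separated v.1 v.2 w.1).

Lemma separated_notin (v w : form PL -> Prop) phi :
  separated v phi w -> ~ w phi.
Proof. by move=> /(_ [::]); apply. Qed.

(** The full theory omits no formula, so only the empty list has to be tested. *)
Lemma separated_full (w : form PL -> Prop) phi :
  ~ w phi -> separated full_theory phi w.
Proof. by move=> wphi [|ab l] // H; inversion_clear H; case: H0 => _ []. Qed.

Lemma can_Imp_succ (w : theory) a b : ~ w (Imp a b) ->
  exists v : theory, [/\ separated v Bot w, v a & ~ v b].
Proof.
move=> wab.
(* Keeping [a] outside [X] makes the empty chain harmless: its union satisfies [P] because of
   [wab]. *)
pose P X := forall c, derivable_K (a |` X) c -> ~ w (Imp c b).
have [|X [PX maxX]] := @Zorn_bigcup _ P.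
  move=> F FP Ftot c [s /(Forall_chain_union Ftot) [sa|[X FX sX]] sc]; last first.
    by apply: (FP X FX); exists s.
  move=> wcb; apply: wab; apply: thy_ImpTr wcb; apply: thy_DT0.
  apply: K_Cut sc; apply: derives_K_bigAndR.
  by apply: List.Forall_impl sa => _ ->; apply: K_A.
pose v := derivable_theory (a |` X); exists v.
have va : v a by apply: sub_derivable_K; left.
have vb : ~ v b by move=> /PX; apply; apply: thy_DT0 (K_A _).
split=> // l lv wl.
(* By maximality, adding an omitted [c] to [X] violates [P]; [f c] is the share of [v] in that
   violation. [Top] is a dummy value for [c] in [v]. *)
have /choice [f fP] : forall c, exists d, ~ v c -> v d /\ w (Imp (And d c) b).
  move=> c.
  have [vc|vc] := pselect (v c); first by exists Top.
  have XcX : X `<` (c |` X).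
    split=> [d|/(_ c (or_introl erefl)) Xc]; first by right.
    by apply: vc; apply: sub_derivable_K; right.
  have /existsNP [d /not_implyP [Xd /contrapT wd]] := maxX _ XcX.
  rewrite setUCA in Xd; have [e ve ecd] := derivable_K_setU1 Xd.
  by exists e => _; split=> //; apply: thy_ImpTr wd; apply: thy_DT0.
have [l0|lN0] := pselect (l = [::]).
  by apply: wab; apply: thy_mono wl; rewrite l0; apply: K_Bot.
have {}wl := thy_mono (disj_Imp_Bot l) wl.
have wfl : w (bigAnd [seq Imp (And (f ab.2) ab.2) b | ab <- l]).
  apply/thy_bigAnd/List.Forall_map.
  by apply: List.Forall_impl lv => ab [_ /fP[]].
have vfl : v (bigAnd [seq And (f ab.2) ab.1 | ab <- l]).
  apply/thy_bigAnd/List.Forall_map.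
  by apply: List.Forall_impl lv => ab [va1 /fP[vf _]]; apply: thy_And.
(* [K_ImpOrS] with [f ab.2] as side formulas puts into [w] an implication to [b] whose antecedent
   lies in [v], against [PX]. *)
apply: PX vfl _; apply: thy_mono (thy_And wl wfl).
exact: (derives_K_ImpOrS_seq (fun ab => f ab.2)).
Qed.

Definition can_truth a : set (world can_frame) :=
  [set w : theory * form PL | w.1 a].

(** The second component of a world bars that formula from all its predecessors, so
    [(full_theory, a)] is the witness. *)
Lemma can_truth_notin (w : world can_frame) a : ~ can_truth a w ->
  exists2 v, acc w v & forall u, acc u v -> ~ can_truth a u.
Proof.
move=> wa; exists (full_theory, a); first exact: separated_full.
by move=> u; apply: separated_notin.
Qed.

Lemma FP_can_truth a : FP (can_truth a).
Proof.
exists (pdia (can_truth a)) => //; apply/seteqP; split=> w; last first.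
  by move=> wa v wv; exists w.
move=> wa; apply: contrapT => /can_truth_notin [v wv va].
by have [u ua /va] := wa _ wv.
Qed.

Definition can_model : bd_model PL :=
  @BdModel PL can_frame (fun p => can_truth (Var p))
    (fun p => FP_can_truth (Var p)).

(** If the theories generated by [a] and by [b] both failed, the two offending lists, concatenated,
    would give a disjunction derivable from each, hence lying in [w]. *)
Lemma can_Or_pred (w : theory) (v : form PL -> Prop) phi a b :
  w (Or a b) -> separated v phi w ->
  exists2 u : theory, u a \/ u b & separated v phi u.
Proof.
move=> wab wv; apply: contrapT => nu.
have nsep c : c = a \/ c = b -> exists2 l,
    List.Forall (fun ab => v ab.1 /\ ~ v ab.2) l & derives_K c (disj_Imp phi l).
  move=> cab; apply: contrapT => nl; apply: nu; exists (principal_theory c).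
    by case: cab => <-; [left|right]; apply: K_A.
  by move=> l lv cl; apply: nl; exists l.
have [l1 l1v al1] := nsep a (or_introl erefl).
have [l2 l2v bl2] := nsep b (or_intror erefl).
apply: (wv (l1 ++ l2)); first exact/List.Forall_app.
apply: thy_mono wab; apply: K_OrL.
  exact: K_Cut al1 (disj_Imp_catl _ _ _).
exact: K_Cut bl2 (disj_Imp_catr _ _ _).
Qed.

Lemma truth_can_model a : truth can_model a = can_truth a.
Proof.
elim: a => [p||a IHa b IHb|a IHa b IHb|a IHa b IHb] //=; rewrite ?IHa ?IHb;
  apply/seteqP; split=> w.
- move=> w0; apply: contrapT => /can_truth_notin [v wv _].
  exact: w0 wv.
(* A theory with [Bot] contains every formula, including the one that [v] forbids, so such a world
   has no successor. *)
- move=> w0 v /separated_notin; apply.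
  by apply: thy_mono w0; apply: K_Bot.
- by move=> [wa wb]; apply: thy_And.
- by move=> wab; split; apply: thy_mono wab; [apply: K_AndL1|apply: K_AndL2].
- move=> wab; apply: contrapT => /can_truth_notin [v wv vab].
  have [u [ua|ub] /vab] := wab _ wv; apply.
    by apply: thy_mono ua; apply: K_OrR1.
  by apply: thy_mono ub; apply: K_OrR2.
- move=> wab v wv; have [u uab uv] := can_Or_pred wab wv.
  by exists (u, Bot).
- move=> wab; apply: contrapT => /can_Imp_succ [v [wv va vb]].
  by have [] := wab (v, Bot) wv.
- move=> wab v wv; have [va|] := pselect (can_truth a v); last by left.
  right; apply: contrapT => vb.
  (* If [v] had [a] but not [b], this one-element list would break separation. *)
  apply: (wv [:: (a, b)]); first by do 2?constructor.
  by apply: thy_mono wab; apply: K_OrR1.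
Qed.

End Theories.

Theorem theorem1 (PL : countType) (G : set (form PL)) (phi : form PL) :
  derivable_K G phi <-> entails_K G phi.
Proof.
split=> [[s Gs sphi] M w wG|GK].
  apply: (derives_K_sound sphi).
  elim: Gs {sphi} => [|a [|b t] Ga _ IH]; [|exact: wG|by split; [apply: wG|]].
  by rewrite /= setvU.
(* Truth at this world is derivability from [G]; the formula paired with the theory may be chosen
   freely. *)
have := GK (can_model PL) (derivable_theory G, Bot).
rewrite truth_can_model; apply=> g Gg.
by rewrite truth_can_model; apply: sub_derivable_K.
Qed.
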